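(* Let $m\ge1$, and for $\lambda\in\mathbb{C}$ and $\alpha_1,\dots,\alpha_m\in\mathbb{C}$ let $$\rho_\lambda(\alpha_1,\dots,\alpha_m)=\frac12(1+\lambda)\prod_{i=1}^m(1-\alpha_i-\alpha_i\lambda)^2+\frac12(1-\lambda)\prod_{i=1}^m(1-\alpha_i+\alpha_i\lambda)^2.$$ Let $c_i=-\cos\left(\frac{2\pi i}{2m+1}\right)$ and $\hat\alpha_i=\frac{1}{1+c_i}$ for $i=1,\dots,m$. Then for every $\lambda\in\mathbb{C}$, $$\rho_\lambda(\hat\alpha_1,\dots,\hat\alpha_m)=\frac{1}{(2m+1)^2}.$$ *)

(* Defs.v *)
From HB Require Import structures.
From mathcomp Require Import all_boot all_order all_algebra.
From mathcomp Require Import reals topology normedtype sequences trigo.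
From mathcomp Require Import complex.

Set Implicit Arguments.
Unset Strict Implicit.
Unset Printing Implicit Defensive.

Import Order.TTheory GRing.Theory Num.Theory.

Local Open Scope ring_scope.
Local Open Scope complex_scope.

(* The complex numbers are R[i] over an arbitrary R : realType. The entries
   alpha_1, ..., alpha_m are indexed by 'I_m, so the mathematical index of
   i : 'I_m is i.+1. *)

Definition rho (R : realType) (m : nat) (lambda : R[i]) (alpha : 'I_m -> R[i])
  : R[i] :=
  1 / 2 * (1 + lambda) * \prod_(i < m) (1 - alpha i - alpha i * lambda) ^+ 2
  + 1 / 2 * (1 - lambda) * \prod_(i < m) (1 - alpha i + alpha i * lambda) ^+ 2.

Definition c_hat (R : realType) (m : nat) (i : 'I_m) : R :=
  - cos (2 * pi * (i.+1)%:R / (2 * m + 1)%:R).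

Definition alpha_hat (R : realType) (m : nat) (i : 'I_m) : R[i] :=
  (1 / (1 + c_hat R i))%:C.

(* Main.v *)
Require Import Defs.
From HB Require Import structures.
From mathcomp Require Import all_boot all_order all_algebra.
From mathcomp Require Import reals topology normedtype sequences trigo.
From mathcomp Require Import complex.
From mathcomp Require Import ring lra zify.

(** Write n = 2m + 1, t_k = 2 pi k / n and let P(x) be the product of the
    x - cos t_k for k = 1, ..., m. Since alpha_k = 1 / (1 - cos t_k), the two
    products in rho are P(-lambda)^2 / P(1)^2 and P(lambda)^2 / P(1)^2.
    Everything is computed through the Joukowski substitution
    lambda = (z + 1/z) / 2, which is solvable over the complex numbers. It turns
    lambda - cos t_k into (z - w)(z - 1/w) / (2 z) with w = e^(i t_k), and pairing
    each n-th root of unity w != 1 with its inverse gives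
      (2z)^m P(lambda) = 1 + z + ... + z^(n-1)
    ([prod_quadratics_cos]). At z = 1 this evaluates P(1) = n / 2^m. For general
    z, the weights 1 - lambda = - (z - 1)^2 / (2z) and
    1 + lambda = (z + 1)^2 / (2z) complete the squared geometric sums in z and
    -z to (z^n - 1)^2 and (z^n + 1)^2 because n is odd, and
    (z^n + 1)^2 - (z^n - 1)^2 = 4 z^n cancels the powers of z
    ([weighted_prod_cos]). *)

Set Implicit Arguments.
Unset Strict Implicit.
Unset Printing Implicit Defensive.

Import Order.TTheory GRing.Theory Num.Theory.

Local Open Scope ring_scope.
Local Open Scope complex_scope.

(** The quotient of X^n - 1 by X - 1, with its linear factors grouped in pairs
    of inverse roots. The division is carried out on polynomials, so that the
    value x = 1 is covered. *)
Lemma prod_paired_unity_roots (F : fieldType) (m : nat) (w x : F) :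
  (2 * m + 1)%N.-primitive_root w ->
  \prod_(i < m) ((x - w ^+ i.+1) * (x - w ^+ (2 * m + 1 - i.+1))) =
  \sum_(k < 2 * m + 1) x ^+ k.
Proof.
move=> prim_w; set n := (2 * m + 1)%N.
have quotient_prod :
    \prod_(1 <= i < n) ('X - (w ^+ i)%:P) = \sum_(k < n) 'X^k :> {poly F}.
  apply: (mulfI (negbT (polyXsubC_eq0 1))).
  by rewrite -subrX1 -(factor_Xn_sub_1 prim_w) [RHS]big_ltn ?expr0 // /n addn1.
have := congr1 (horner^~ x) quotient_prod.
rewrite horner_prod horner_sum.
rewrite (eq_bigr (fun i => x - w ^+ i)); last by move=> i _; rewrite !hornerE.
under [X in _ = X -> _]eq_bigr do rewrite hornerXn.
move=> <-.
rewrite (@big_cat_nat _ _ _ m.+1) /=; [|by []|by rewrite /n; lia].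
rewrite big_split /= big_add1 big_mkord; congr (_ * _).
rewrite big_nat_rev /= -{1}[m.+1]add0n big_addn big_mkord.
have -> : (n - m.+1 = m)%N by rewrite /n; lia.
apply: eq_bigr => i _; congr (_ - _ ^+ _).
by rewrite /n; have := ltn_ord i; lia.
Qed.

Section UnitCircle.

Variable R : realType.
Implicit Types (x t : R) (z lambda : R[i]) (m n k : nat).

Lemma deMoivre t k :
  (cos t +i* sin t) ^+ k = cos (t *+ k) +i* sin (t *+ k) :> R[i].
Proof.
elim: k => [|k IHk]; first by rewrite expr0 mulr0n cos0 sin0.
rewrite exprS IHk mulrS cosD sinD; apply/eqP; rewrite eq_complex /=.
by rewrite eqxx /= [X in _ == X]addrC addrC.
Qed.

Definition angle n : R := 2 * pi / n%:R.

Lemma prim_root_unit_circle n : (0 < n)%N ->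
  n.-primitive_root (cos (angle n) +i* sin (angle n) : R[i]).
Proof.
move=> n_gt0; have nR_gt0 : 0 < n%:R :> R by rewrite ltr0n.
rewrite /primitive_root_of_unity n_gt0; apply/forallP => i.
rewrite unity_rootE deMoivre; apply/eqP.
have -> : angle n *+ i.+1 = (pi * i.+1%:R / n%:R) *+ 2.
  by rewrite /angle -mulr_natr -[RHS]mulr_natl; ring.
have [->|i_neq] := eqVneq i.+1 n.
  by rewrite mulfK ?(gt_eqF nR_gt0) // cos2pi sin2pi; exact: eqxx.
(* A smaller power would equal 1 only if its half angle, strictly between 0 and
   pi, had a vanishing sine. *)
apply/negP => /eqP/(congr1 (@complex.Re R)) /=.
rewrite cos_mulr2n cos2sin2 => cos_eq1.
suff : 0 < sin (pi * i.+1%:R / n%:R) ^+ 2 :> R.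
  by rewrite lt0r => /andP[/eqP + _]; apply; lra.
rewrite exprn_gt0 // sin_gt0_pi // divr_gt0 ?mulr_gt0 ?pi_gt0 ?ltr0n //=.
by rewrite ltr_pdivrMr // ltr_pM2l ?pi_gt0 // ltr_nat ltn_neqAle i_neq ltn_ord.
Qed.

(** The conjugate factors z - e^(it) and z - e^(-it), for t running through the
    first m multiples of the angle, exhaust the non-trivial roots of unity. *)
Lemma prod_quadratics_cos m z :
  \prod_(i < m) (z ^+ 2 - 2 * (cos (angle (2 * m + 1) *+ i.+1))%:C * z + 1) =
  \sum_(k < 2 * m + 1) z ^+ k.
Proof.
have prim_w := @prim_root_unit_circle (2 * m + 1) ltac:(by rewrite addn1).
rewrite -(prod_paired_unity_roots _ prim_w); apply: eq_bigr => i _.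
set w := _ +i* _ in prim_w *; set t := angle _ *+ _.
have le_i : (i.+1 <= 2 * m + 1)%N by have := ltn_ord i; lia.
have w_i : w ^+ i.+1 = cos t +i* sin t by rewrite deMoivre.
have w_conj : w ^+ i.+1 * (cos t -i* sin t) = 1.
  rewrite w_i; apply/eqP; rewrite eq_complex /=; apply/andP.
  by split; apply/eqP; [rewrite -(cos2Dsin2 t)|]; ring.
have w_inv : w ^+ i.+1 * w ^+ (2 * m + 1 - i.+1) = 1.
  by rewrite -exprD subnKC // prim_expr_order.
have -> : w ^+ (2 * m + 1 - i.+1) = cos t -i* sin t.
  by rewrite -[LHS]mulr1 -w_conj mulrCA mulrA w_inv mul1r.
have cos_sum : 2 * (cos t)%:C = w ^+ i.+1 + (cos t -i* sin t).
  rewrite w_i mulr_natl mulr2n.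
  by apply/eqP; rewrite eq_complex /= subrr addr0 !eqxx.
rewrite cos_sum -w_conj; ring.
Qed.

Definition prod_sub_cos m lambda : R[i] :=
  \prod_(i < m) (lambda - (cos (angle (2 * m + 1) *+ i.+1))%:C).

(** The relation between z and lambda is lambda = (z + 1/z) / 2, written without
    the inverse. *)
Lemma prod_sub_cos_joukowski m lambda z : z ^+ 2 + 1 = 2 * lambda * z ->
  (2 * z) ^+ m * prod_sub_cos m lambda = \sum_(k < 2 * m + 1) z ^+ k.
Proof.
move=> z_lambda; rewrite -prod_quadratics_cos -[X in _ ^+ X]card_ord.
rewrite -prodr_const -big_split /=; apply: eq_bigr => i _.
by rewrite addrAC z_lambda; ring.
Qed.

Lemma prod_sub_cos1 m : 2 ^+ m * prod_sub_cos m 1 = (2 * m + 1)%:R.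
Proof.
have := @prod_sub_cos_joukowski m 1 1; rewrite !mulr1 => -> //.
  by under eq_bigr do rewrite expr1n; rewrite sumr_const card_ord.
by rewrite expr1n.
Qed.

(** The equation is quadratic in z; its two roots have product 1, so neither
    vanishes. *)
Lemma joukowski_surj lambda : exists2 z, z != 0 & z ^+ 2 + 1 = 2 * lambda * z.
Proof.
pose s := sqrtC (lambda ^+ 2 - 1).
have z_lambda : (lambda + s) ^+ 2 + 1 = 2 * lambda * (lambda + s).
  have s2 : s ^+ 2 = lambda ^+ 2 - 1 by exact: sqrtCK.
  by rewrite sqrrD s2; ring.
exists (lambda + s) => //; apply/eqP => z0.
by move/eqP: z_lambda; rewrite z0 expr0n mulr0 add0r oner_eq0.
Qed.

(** With n = 2m + 1 and the prefactor distributed, the two summands are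
    1 + T_n(lambda) and 1 - T_n(lambda) for the Chebyshev polynomial T_n, hence
    the constant sum. The proof uses T_n(lambda) = (z^n + z^(-n)) / 2 only
    implicitly: 1 + T_n and 1 - T_n are (z^n + 1)^2 / (2 z^n) and
    - (z^n - 1)^2 / (2 z^n). *)
Lemma weighted_prod_cos m lambda :
  (2 ^+ m) ^+ 2 * ((1 + lambda) * prod_sub_cos m (- lambda) ^+ 2 +
                   (1 - lambda) * prod_sub_cos m lambda ^+ 2) = 2.
Proof.
have [z z_neq0 z_lambda] := joukowski_surj lambda.
set n := (2 * m + 1)%N.
have geom := subrX1 z n.
have geomN := subrX1 (- z) n.
rewrite -(prod_sub_cos_joukowski _ z_lambda) in geom.
have zN_lambda : (- z) ^+ 2 + 1 = 2 * - lambda * - z.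
  by rewrite sqrrN z_lambda; ring.
rewrite -(prod_sub_cos_joukowski _ zN_lambda) in geomN.
have odd_n : (- z) ^+ n = - z ^+ n.
  by rewrite exprNn -signr_odd /n addn1 /= mul2n odd_double expr1 mulN1r.
rewrite odd_n in geomN.
set P := prod_sub_cos m lambda in geom *.
set Q := prod_sub_cos m (- lambda) in geomN *.
have z_n : z ^+ n = z * (z ^+ m) ^+ 2 by rewrite /n addn1 exprS mulnC exprM.
have signs : ((2 * - z) ^+ m) ^+ 2 = ((2 * z) ^+ m) ^+ 2.
  by rewrite mulrN -!exprM mulnC !exprM sqrrN.
(* Clearing the denominator 2 z^n leaves the difference of two squares. *)
apply: (@mulfI _ (2 * z ^+ n)).
  by rewrite mulf_neq0 ?expf_neq0 ?pnatr_eq0.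
have squareQ :
    (- z ^+ n - 1) ^+ 2 = (z + 1) ^+ 2 * (((2 * z) ^+ m) ^+ 2 * Q ^+ 2).
  by rewrite geomN -signs; ring.
have squareP :
    (z ^+ n - 1) ^+ 2 = (z - 1) ^+ 2 * (((2 * z) ^+ m) ^+ 2 * P ^+ 2).
  by rewrite geom; ring.
have -> : 2 * z ^+ n * 2 = (- z ^+ n - 1) ^+ 2 - (z ^+ n - 1) ^+ 2 by ring.
rewrite squareQ squareP z_n exprMn.
have -> : (z + 1) ^+ 2 = 2 * z * (1 + lambda).
  by rewrite sqrrD mulr1 expr1n addrAC z_lambda; ring.
have -> : (z - 1) ^+ 2 = - (2 * z * (1 - lambda)).
  by rewrite sqrrB mulr1 expr1n addrAC z_lambda; ring.
ring.
Qed.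

End UnitCircle.

Theorem proposition6p2 (R : realType) (m : nat) (hm : (1 <= m)%N)
    (lambda : R[i]) :
  rho lambda (@alpha_hat R m) = 1 / ((2 * m + 1)%:R ^+ 2).
Proof.
set n := (2 * m + 1)%N.
have P1 := prod_sub_cos1 R m; rewrite -/n in P1.
have n_neq0 : n%:R != 0 :> R[i] by rewrite pnatr_eq0 /n addn1.
have two_neq0 : 2 ^+ m != 0 :> R[i] by rewrite expf_neq0 // pnatr_eq0.
have P1_neq0 : prod_sub_cos m (1 : R[i]) != 0.
  by apply: contraNneq n_neq0 => P1_0; rewrite -P1 P1_0 mulr0.
pose c i : R[i] := (cos (angle R n *+ i.+1))%:C.
have factor_neq0 (i : 'I_m) : 1 - c i != 0.
  by move/prodf_neq0: P1_neq0; apply.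
have alphaE (i : 'I_m) : alpha_hat R i = (1 - c i)^-1.
  rewrite /alpha_hat /c_hat div1r fmorphV rmorphB rmorph1.
  by congr ((1 - (cos _)%:C)^-1); rewrite /angle -[RHS]mulr_natr mulrAC.
have prod_alphaP :
    \prod_(i < m) (1 - alpha_hat R i + alpha_hat R i * lambda) ^+ 2 =
    (prod_sub_cos m lambda / prod_sub_cos m 1) ^+ 2.
  rewrite -prodf_div -prodrXl; apply: eq_bigr => i _; congr (_ ^+ _).
  by rewrite alphaE -/(c i); field; exact: factor_neq0.
have prod_alphaQ :
    \prod_(i < m) (1 - alpha_hat R i - alpha_hat R i * lambda) ^+ 2 =
    (prod_sub_cos m (- lambda) / prod_sub_cos m 1) ^+ 2.
  rewrite -prodf_div -prodrXl; apply: eq_bigr => i _; congr (_ ^+ _).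
  by rewrite alphaE -/(c i); field; exact: factor_neq0.
rewrite /rho prod_alphaP prod_alphaQ.
have sum_PQ := weighted_prod_cos m lambda.
rewrite -P1.
set P := prod_sub_cos m lambda in sum_PQ *.
set Q := prod_sub_cos m (- lambda) in sum_PQ *.
set D := prod_sub_cos m 1 in P1_neq0 *.
transitivity (((2 ^+ m) ^+ 2 * ((1 + lambda) * Q ^+ 2 + (1 - lambda) * P ^+ 2))
              / (2 * (2 ^+ m * D) ^+ 2)).
  by field; rewrite P1_neq0 two_neq0.
rewrite sum_PQ; field; by rewrite P1_neq0 two_neq0.
Qed.
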